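(* Let $\mathbb{T}$ be a time scale, $a,b\in\mathbb{T}$ with $a<b$, $B\in\mathbb{R}$, and let $\varphi:[a,b]^\kappa_{\mathbb{T}}\to\mathbb{R}$ be a positive and rd-continuous function. Then, among all $C^1_{\mathrm{rd}}$ functions $y:[a,b]_{\mathbb{T}}\to\mathbb{R}$ with $y(a)=0$ and $y(b)=B$, the functional $$F[y(\cdot)]=\int_a^b\varphi(t)e^{y^\Delta(t)}\Delta t$$ has minimum value $F_{\min}=(b-a)e^C$ attained when $$y(t)=-\int_a^t\ln(\varphi(s))\Delta s+C(t-a),\quad t\in[a,b]_{\mathbb{T}},$$ where $$C=\frac{\int_a^b\ln(\varphi(t))\Delta t+B}{b-a}.$$
   Context: A time scale is a nonempty closed subset of $\mathbb{R}$; $[a,b]_{\mathbb{T}}=[a,b]\cap\mathbb{T}$, and $[a,b]^\kappa_{\mathbb{T}}$ is $[a,b]_{\mathbb{T}}$ without $b$ if $b$ is left-scattered ($\rho(b)<b$), and $[a,b]_{\mathbb{T}}$ otherwise. $\sigma(t)=\inf\{s\in\mathbb{T}:s>t\}$, $\rho(t)=\sup\{s\in\mathbb{T}:s<t\}$. $f^\Delta(t)$ is the $\Delta$-derivative: for each $\varepsilon>0$, $|f(\sigma(t))-f(s)-f^\Delta(t)(\sigma(t)-s)|\le\varepsilon|\sigma(t)-s|$ for $s$ in a neighborhood of $t$. A function is rd-continuous if it is continuous at right-dense points ($\sigma(t)=t$) and has finite left limits at left-dense points ($\rho(t)=t$). $C^1_{\mathrm{rd}}$: $\Delta$-differentiable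 with rd-continuous $\Delta$-derivative. $\int_a^b f\Delta t=F(b)-F(a)$ with $F^\Delta=f$.
   Formalization: The formal theorem also assumes that the left limits of φ at left-dense points t > a are positive; without this (e.g. φ(s)=1−s on [0,1), φ(1)=1, with 1 right-scattered) the stated y is not C¹_rd and the claim fails. *)

(* Defs.v *)
From mathcomp Require Import all_boot all_order all_algebra.
From mathcomp Require Import all_classical all_reals all_analysis.

Set Implicit Arguments.
Unset Strict Implicit.
Unset Printing Implicit Defensive.

Import Order.TTheory GRing.Theory Num.Theory.
Import numFieldNormedType.Exports.

Local Open Scope classical_set_scope.
Local Open Scope ring_scope.

(* A function on (a subset of) a time scale X is represented by a total function
   R -> R; every notion below depends only on its values on the relevant set. *)

Definition time_scale (R : realType) (X : set R) : Prop :=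
  closed X /\ X !=set0.

Definition ts_itv (R : realType) (T : set R) (a b : R) : set R :=
  `[a, b] `&` T.

(* inf of the empty set is read as sup X, so that sigma X (max X) = max X;
   the library's own inf set0 is 0. *)
Definition sigma (R : realType) (X : set R) (t : R) : R :=
  if `[< exists2 s, X s & t < s >] then inf [set s | X s /\ t < s] else sup X.

(* Dually, sup of the empty set is read as inf X. *)
Definition rho (R : realType) (X : set R) (t : R) : R :=
  if `[< exists2 s, X s & s < t >] then sup [set s | X s /\ s < t] else inf X.

(* X deprived of its maximum when X has a left-scattered maximum. *)
Definition kappa (R : realType) (X : set R) : set R :=
  [set t | X t /\ ~ (ubound X t /\ rho X t < t)].

Definition is_delta_deriv (R : realType) (X : set R) (f : R -> R) (t d : R)
    : Prop :=
  forall e : R, 0 < e -> \forall s \near nbhs t, X s ->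
    `|f (sigma X t) - f s - d * (sigma X t - s)| <= e * `|sigma X t - s|.

(* The value is 0 where f is not Delta-differentiable; at points of kappa X the
   Delta-derivative is unique. *)
Definition delta_deriv (R : realType) (X : set R) (f : R -> R) (t : R) : R :=
  xget 0 [set d | is_delta_deriv X f t d].

(* f has domain D, a subset of the time scale X. Density of a point refers to X,
   while limits are taken along D. *)
Definition rd_continuous (R : realType) (X D : set R) (f : R -> R) : Prop :=
  forall t, D t ->
    (sigma X t = t -> f @ within D (nbhs t) --> f t) /\
    (rho X t = t ->
      exists l : R, f @ within (D `&` [set s | s < t]) (nbhs t) --> l).

Definition C1rd (R : realType) (X : set R) (f : R -> R) : Prop :=
  (forall t, kappa X t -> exists d, is_delta_deriv X f t d) /\
  rd_continuous X (kappa X) (delta_deriv X f).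

Definition is_antideriv (R : realType) (X : set R) (f F : R -> R) : Prop :=
  forall t, kappa X t -> is_delta_deriv X F t (f t).

(* The integral of f from c to d, for c and d in X, is F d - F c with F an
   antiderivative of f on the whole of X; it is 0 if f has no antiderivative. *)
Definition delta_int (R : realType) (X : set R) (f : R -> R) (c d : R) : R :=
  let F := xget (fun=> 0) [set F | is_antideriv X f F] in F d - F c.

(* For a left-dense b, the Delta-derivative at b of a function on [a, b]_T can
   only see [a, b]_T, so all notions are applied to the time scale [a, b]_T.
   This affects neither sigma on [a, b[ nor rho on ]a, b], and in particular
   kappa gives the usual [a, b]^kappa_T: *)
Lemma kappa_itvE (R : realType) (T : set R) (a b : R) :
  T a -> T b -> a < b ->
  kappa (ts_itv T a b) =
    if rho T b < b then ts_itv T a b `\ b else ts_itv T a b.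
Proof.
move=> Ta Tb ab.
have Ib : ts_itv T a b b by split => //=; rewrite in_itv/= ltW//= lexx.
have Ub : ubound (ts_itv T a b) b.
  by move=> s [/=]; rewrite in_itv/= => /andP[].
have rhoE : rho (ts_itv T a b) b = rho T b.
  rewrite /rho !asboolT; [|by exists a|exists a => //].
  - apply/eqP; rewrite eq_le; apply/andP; split.
      apply: ge_sup.
        exists a; split => //; split => //=.
        by rewrite in_itv/= lexx ltW.
      move=> s [[_ Ts] sb]; apply: ub_le_sup; last by split.
      by exists b => u [_ /ltW].
    apply: ge_sup; first by exists a.
    have hU : has_ubound [set s | ts_itv T a b s /\ s < b].
      by exists b => u [_ /ltW].
    move=> s [Ts sb]; have [as_|sa] := leP a s.
      apply: ub_le_sup => //; split => //; split => //=.
      by rewrite in_itv/= as_ ltW.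
    apply: (le_trans (ltW sa)); apply: ub_le_sup => //.
    by split => //; split => //=; rewrite in_itv/= lexx ltW.
  - by split => //=; rewrite in_itv/= lexx ltW.
apply/seteqP; split => t.
  move=> [It nt]; case: ifPn => // rb; split => // tb.
  by apply: nt; rewrite tb; split => //; rewrite rhoE.
case: ifPn => [rb [It /= tb]|rb It]; split => // -[Ut rt].
  by apply: tb; apply/eqP; rewrite eq_le (Ub _ It) (Ut _ Ib).
have tb : t = b by apply/eqP; rewrite eq_le (Ub _ It) (Ut _ Ib).
by move: rt; rewrite tb rhoE (negbTE rb).
Qed.

Definition exp_functional (R : realType) (X : set R) (phi : R -> R) (a b : R)
    (y : R -> R) : R :=
  delta_int X (fun t => phi t * expR (delta_deriv X y t)) a b.

Definition admissible (R : realType) (X : set R) (a b B : R) (y : R -> R)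
    : Prop :=
  [/\ C1rd X y, y a = 0 & y b = B].

(* Main.v *)
Require Import Defs.
From mathcomp Require Import all_boot all_order all_algebra.
From mathcomp Require Import all_classical all_reals all_analysis.
From mathcomp Require Import lra ring.
Import Order.TTheory GRing.Theory Num.Theory.
Import numFieldNormedType.Exports.
Local Open Scope classical_set_scope.
Local Open Scope ring_scope.

(** Write I for an antiderivative of ln phi vanishing at a, and put
    x t = y^Delta t + ln (phi t) - C. The tangent inequality 1 + x <= e^x, scaled
    by e^C, reads

      e^C (1 + y^Delta t + ln (phi t) - C) <= phi t * e^(y^Delta t).

    Integrating over [a, b] turns the left side into
    e^C ((1 - C) (b - a) + B + I b), and the value of C is precisely the one for
    which C (b - a) = I b + B, so that this is (b - a) e^C
    ([exp_functional_ge]). The tangent inequality is an equality when x = 0, that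
    is y^Delta = C - ln phi; the primitive of this function that vanishes at a is
    the announced minimizer, its integrand is the constant e^C, and the same value
    of C makes it equal to B at b.

    Three facts of calculus on a compact time scale carry this argument.
    A function with nonnegative Delta-derivative does not decrease
    ([delta_deriv_ge0_le]); hence integrals are monotone and do not depend on the
    antiderivative ([antideriv_le], [delta_intE]). The Delta-derivative is unique
    on kappa X ([delta_deriv_uniq]), which identifies it for the minimizer. Every
    rd-continuous function has an antiderivative ([rd_continuous_antideriv]);
    without this, the integrals of the statement would be the default value 0. The
    antiderivative is built as an upper Darboux integral, which needs the function
    to be bounded ([rd_continuous_bounded]) but calls for no measurability.
    Boundedness and monotonicity are both obtained by the induction principle of
    time scales, [ts_ind]. *)

(** * Compact time scales *)

Section CompactTimeScale.
Set Implicit Arguments.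
Unset Strict Implicit.
Context (R : realType) (X : set R) (a b : R).
Definition ts_segment : Prop :=
  [/\ closed X, X a, X b, a < b & forall t, X t -> a <= t <= b].

Hypothesis Xab : ts_segment.

Let Xclosed : closed X. Proof. by case: Xab. Qed.
Let Xa : X a. Proof. by case: Xab. Qed.
Let Xb : X b. Proof. by case: Xab. Qed.
Let ab : a < b. Proof. by case: Xab. Qed.

Lemma ts_ge t : X t -> a <= t.
Proof. by case: Xab => _ _ _ _ h /h/andP[]. Qed.

Lemma ts_le t : X t -> t <= b.
Proof. by case: Xab => _ _ _ _ h /h/andP[]. Qed.

Lemma ts_sup A : A `<=` X -> A !=set0 -> X (sup A).
Proof.
move=> AX A0; apply: Xclosed; apply: (closureS AX).
by apply: closure_sup => //; exists b => t /AX /ts_le.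
Qed.

Lemma ts_inf A : A `<=` X -> A !=set0 -> X (inf A).
Proof.
move=> AX A0; have Al : has_lbound A by exists a => t /AX /ts_ge.
apply: Xclosed => V /nbhs_ballP[e /= e0 eV].
have [t At te] := inf_adherent e0 (conj A0 Al).
exists t; split; first exact: AX.
apply: eV; rewrite /ball/= ler0_norm; first by lra.
by rewrite subr_le0 ge_inf.
Qed.

Lemma sup_ts : sup X = b.
Proof.
apply/eqP; rewrite eq_le ge_sup ?ub_le_sup//.
- by exists b => t /ts_le.
- by exists a.
- by move=> t /ts_le.
Qed.

Lemma inf_ts : inf X = a.
Proof.
apply/eqP; rewrite eq_le ge_inf ?lb_le_inf//.
- by exists a.
- by move=> t /ts_ge.
- by exists a => t /ts_ge.
Qed.

Lemma sigma_le t s : X s -> t < s -> sigma X t <= s.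
Proof.
move=> Xs ts; rewrite /sigma asboolT; last by exists s.
by apply: ge_inf => //; exists a => u [/ts_ge].
Qed.

Lemma rho_ge t s : X s -> s < t -> s <= rho X t.
Proof.
move=> Xs ts; rewrite /rho asboolT; last by exists s.
by apply: ub_le_sup => //; exists b => u [/ts_le].
Qed.

Lemma sigma_in t : X (sigma X t).
Proof.
rewrite /sigma; case: asboolP => [[s Xs ts]|_]; last by rewrite sup_ts.
by apply: ts_inf; [move=> u []|exists s].
Qed.

Lemma rho_in t : X (rho X t).
Proof.
rewrite /rho; case: asboolP => [[s Xs ts]|_]; last by rewrite inf_ts.
by apply: ts_sup; [move=> u []|exists s].
Qed.

Lemma sigma_ge t : X t -> t <= sigma X t.
Proof.
move=> Xt; rewrite /sigma; case: asboolP => [[s Xs ts]|_].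
  by apply: lb_le_inf; [exists s|move=> u [_ /ltW]].
by rewrite sup_ts ts_le.
Qed.

Lemma rho_le t : X t -> rho X t <= t.
Proof.
move=> Xt; rewrite /rho; case: asboolP => [[s Xs ts]|_].
  by apply: ge_sup; [exists s|move=> u [_ /ltW]].
by rewrite inf_ts ts_ge.
Qed.

(** A left-scattered point is thus reached from its predecessor by one forward
    jump, which is how the induction principle gets past it. *)
Lemma sigma_rho t : X t -> rho X t < t -> sigma X (rho X t) = t.
Proof.
move=> Xt rt; apply/eqP; rewrite eq_le sigma_le//=.
rewrite /sigma asboolT; last by exists t.
apply: lb_le_inf; first by exists t.
move=> s [Xs rs]; rewrite leNgt; apply/negP => /(rho_ge Xs).
by rewrite leNgt rs.
Qed.

Lemma right_dense_adherent t e : X t -> t < b -> sigma X t = t -> 0 < e ->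
  exists s, [/\ X s, t < s & s < t + e].
Proof.
move=> Xt tb + e0; rewrite /sigma asboolT; last by exists b.
move=> st; have [|s [Xs ts] se] := @inf_adherent _ [set s | X s /\ t < s] e e0.
  split; first by exists b.
  by exists a => u [/ts_ge].
by exists s; rewrite -[X in _ < X + e]st.
Qed.

Lemma left_dense_adherent t e : X t -> a < t -> rho X t = t -> 0 < e ->
  exists s, [/\ X s, s < t & t - e < s].
Proof.
move=> Xt tb + e0; rewrite /rho asboolT; last by exists a.
move=> st; have [|s [Xs ts] se] := @sup_adherent _ [set s | X s /\ s < t] e e0.
  split; first by exists a.
  by exists b => u [/ts_le].
by exists s; rewrite -[X in X - e < _]st.
Qed.

Lemma kappa_lt t : X t -> t < b -> kappa X t.
Proof. by move=> Xt tb; split=> // -[/(_ _ Xb)]; rewrite leNgt tb. Qed.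

Lemma kappa_max : rho X b = b -> kappa X b.
Proof. by move=> rb; split=> // -[_]; rewrite rb ltxx. Qed.

Lemma kappa_ltVmax t : kappa X t -> t < b \/ t = b /\ rho X b = b.
Proof.
move=> [Xt nt]; have := ts_le Xt; rewrite le_eqVlt => /orP[/eqP tb|]; last by left.
right; split=> //; apply/eqP; rewrite eq_le rho_le//= leNgt; apply/negP => rb.
by apply: nt; rewrite tb; split => // s /ts_le.
Qed.

(** Induction along a compact time scale: otherwise let c be the infimum of the
    points where P fails. P holds below c, hence at c, by passing to the left limit
    or by a jump from rho c. Then P holds slightly beyond c as well, at sigma c or on
    a neighborhood, against the choice of c. *)
Lemma ts_ind (P : R -> Prop) :
    P a ->
    (forall t, X t -> t < sigma X t -> P t -> P (sigma X t)) ->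
    (forall t, X t -> t < b -> sigma X t = t -> P t ->
       \forall s \near nbhs t, X s -> t < s -> P s) ->
    (forall t, X t -> a < t -> rho X t = t ->
       (forall s, X s -> s < t -> P s) -> P t) ->
  forall t, X t -> P t.
Proof.
move=> Pa Psc Prd Pld t Xt; apply: contrapT => nPt.
pose N := [set s | X s /\ ~ P s].
have N0 : N !=set0 by exists t.
have NX : N `<=` X by move=> s [].
have Nl : has_lbound N by exists a => s [/ts_ge].
pose c := inf N; have Xc : X c by exact: ts_inf.
have Pltc s : X s -> s < c -> P s.
  move=> Xs sc; apply: contrapT => nPs.
  by move: sc; rewrite ltNge ge_inf.
have Pc : P c.
  have := ts_ge Xc; rewrite le_eqVlt => /orP[/eqP <-//|ac].
  have := rho_le Xc; rewrite le_eqVlt => /orP[/eqP rc|rc]; first exact: Pld.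
  rewrite -(sigma_rho Xc rc); apply: Psc; [exact: rho_in| |].
    by rewrite sigma_rho.
  by apply: Pltc => //; exact: rho_in.
have ltcN s : N s -> c < s.
  move=> Ns; have := ge_inf Nl Ns; rewrite le_eqVlt => /orP[/eqP cs|//].
  by case: Ns => _; rewrite -cs.
have cb : c < b by apply: lt_le_trans (ltcN t _) (ts_le Xt).
(* N meets every [c, c + d[, since c = inf N, and does not contain c *)
suff [d d0 Pd] : exists2 d, 0 < d & forall s, X s -> c < s -> s < c + d -> P s.
  have [s Ns sd] := inf_adherent d0 (conj N0 Nl).
  by case: (Ns) => Xs; apply; apply: Pd => //; exact: ltcN.
have := sigma_ge Xc; rewrite le_eqVlt => /orP[/eqP/esym sc|csc].
  have /nbhs_ballP[d /= d0 dP] := Prd _ Xc cb sc Pc.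
  exists d => // s Xs cs sd; apply: dP => //.
  by rewrite /ball/= ltr0_norm; lra.
(* s < sigma c is impossible for s in X beyond c: this interval is a gap *)
exists (sigma X c - c); first by rewrite subr_gt0.
move=> s Xs cs; have := sigma_le Xs cs; lra.
Qed.

(** * Delta-derivatives *)

Lemma delta_derivP f t d : is_delta_deriv X f t d <->
  forall e, 0 < e -> exists2 r, 0 < r & forall s, X s -> `|s - t| < r ->
    `|f (sigma X t) - f s - d * (sigma X t - s)| <= e * `|sigma X t - s|.
Proof.
split=> fd e /fd.
  move=> /nbhs_ballP[r /= r0 rP]; exists r => // s Xs st; apply: rP => //.
  by rewrite /ball/= distrC.
move=> [r r0 rP]; apply/nbhs_ballP; exists r => // s /= st Xs; apply: rP => //.
by rewrite distrC.
Qed.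

Lemma delta_deriv_lin c f g df dg t :
  is_delta_deriv X f t df -> is_delta_deriv X g t dg ->
  is_delta_deriv X (fun s => c * f s + g s) t (c * df + dg).
Proof.
move=> fd gd e e0; have c1 : 0 < `|c| + 1 by rewrite ltr_wpDl.
have e1 : 0 < e / 2 / (`|c| + 1) by rewrite !divr_gt0.
have e2 : 0 < e / 2 by rewrite divr_gt0.
apply: filterS2 (fd _ e1) (gd _ e2) => s fs gs Xs.
move: (fs Xs) (gs Xs); set D := sigma X t - s => {}fs {}gs.
rewrite (_ : _ - _ - _ = c * (f (sigma X t) - f s - df * D) +
  (g (sigma X t) - g s - dg * D)); last by ring.
rewrite (le_trans (ler_normD _ _))// (splitr e) mulrDl lerD// normrM.
apply: le_trans (ler_wpM2l (normr_ge0 c) fs) _.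
rewrite mulrA ler_wpM2r// mulrCA ler_piMr ?(ltW e2)//.
by rewrite ler_pdivrMr// mul1r lerDl.
Qed.

Lemma delta_deriv_id t : is_delta_deriv X id t 1.
Proof.
move=> e e0; apply: nearW => s _.
by rewrite mul1r subrr normr0 mulr_ge0 ?(ltW e0).
Qed.

Lemma delta_deriv_cst k t : is_delta_deriv X (fun=> k) t 0.
Proof.
move=> e e0; apply: nearW => s _.
by rewrite mul0r subrr subr0 normr0 mulr_ge0 ?(ltW e0).
Qed.

Lemma le_forall_eps (x y k : R) :
  (forall e, 0 < e -> x <= y + e * k) -> x <= y.
Proof.
move=> xy; apply/ler_addgt0Pr => e e0; have k1 : 0 < `|k| + 1 by rewrite ltr_wpDl.
apply: le_trans (xy (e / (`|k| + 1)) _) _; first by rewrite divr_gt0.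
rewrite lerD2l mulrAC ler_pdivrMr// ler_wpM2l ?(ltW e0)//.
by rewrite (le_trans (ler_norm k))// lerDl.
Qed.

Lemma delta_deriv_step f t d : X t -> is_delta_deriv X f t d ->
  f (sigma X t) - f t = d * (sigma X t - t).
Proof.
move=> Xt /delta_derivP fd; apply/eqP; rewrite -subr_eq0 -normr_le0.
apply: (@le_forall_eps _ _ `|sigma X t - t|) => e e0; rewrite add0r.
have [r r0 rP] := fd e e0; apply: rP => //.
by rewrite subrr normr0.
Qed.

(** At a right-dense point the Delta-derivative is the ordinary derivative
    along X. *)
Lemma delta_deriv_dense f t d : is_delta_deriv X f t d -> sigma X t = t ->
  forall e, 0 < e -> exists2 r, 0 < r & forall s, X s -> `|s - t| < r ->
    `|f s - f t - d * (s - t)| <= e * `|s - t|.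
Proof.
move=> /delta_derivP + st e e0; rewrite st => /(_ e e0)[r r0 rP].
exists r => // s Xs sr; rewrite [X in _ <= _ * X]distrC (_ : _ - _ - _ = - (f t - f s - d * (t - s))).
  by rewrite normrN; exact: rP.
by ring.
Qed.

(** A jump determines the slope by itself; at a right-dense point the slope is a
    limit of difference quotients, and membership in kappa X is what provides
    points of X accumulating at t, on the left if t is the maximum. *)
Lemma delta_deriv_uniq f t d d' : kappa X t ->
  is_delta_deriv X f t d -> is_delta_deriv X f t d' -> d = d'.
Proof.
move=> kt fd fd'; have Xt : X t by case: kt.
have := sigma_ge Xt; rewrite le_eqVlt => /orP[/eqP/esym st|tst]; last first.
  apply: (@mulIf _ (sigma X t - t)); first by rewrite subr_eq0 gt_eqF.
  by rewrite -(delta_deriv_step Xt fd) -(delta_deriv_step Xt fd').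
apply/eqP; rewrite -subr_eq0 -normr_le0.
apply: (@le_forall_eps _ _ 2) => e e0; rewrite add0r.
have [r r0 rP] := delta_deriv_dense fd st e0.
have [r' r'0 r'P] := delta_deriv_dense fd' st e0.
have m0 : 0 < Num.min r r' by rewrite lt_min r0.
have [s [Xs nst]] : exists s, [/\ X s, s != t & `|s - t| < Num.min r r'].
  case: (kappa_ltVmax kt) => [tb|[tb rb]].
    have [s [Xs ts se]] := right_dense_adherent Xt tb st m0.
    exists s; split; rewrite ?gt_eqF// gtr0_norm ?subr_gt0//; lra.
  rewrite -tb in rb; have := ts_ge Xt; rewrite le_eqVlt => /orP[/eqP ta|ta].
    by move: ab; rewrite -tb -ta ltxx.
  have [s [Xs ts se]] := left_dense_adherent Xt ta rb m0.
  exists s; split; rewrite ?lt_eqF// ltr0_norm ?subr_lt0//; lra.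
rewrite lt_min => /andP[/(rP _ Xs) + /(r'P _ Xs)].
have st0 : 0 < `|s - t| by rewrite normr_gt0 subr_eq0.
move=> h h'; rewrite -(ler_pM2r st0) -normrM.
rewrite (_ : _ * (s - t) =
  (f s - f t - d' * (s - t)) - (f s - f t - d * (s - t))); last by ring.
rewrite (le_trans (ler_normB _ _))//.
by rewrite (_ : e * 2 * _ = e * `|s - t| + e * `|s - t|) ?lerD//; ring.
Qed.

(** Comparing the defining estimate at s with the one at t itself removes
    f (sigma t), and leaves an error controlled by sigma t - t. *)
Lemma delta_deriv_continuous f t d : X t -> is_delta_deriv X f t d ->
  forall e, 0 < e -> exists2 r, 0 < r & forall s, X s -> `|s - t| < r ->
    `|f s - f t| <= e.
Proof.
move=> Xt /delta_derivP fd e e0; set D := sigma X t - t.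
have D0 : 0 <= D by rewrite subr_ge0 sigma_ge.
have e1 : 0 < e / (2 * (D + D + 1)) by rewrite divr_gt0//; lra.
have [r r0 rP] := fd _ e1.
have d1 : 0 < e / (2 * (`|d| + 1)).
  by rewrite divr_gt0// mulr_gt0// ltr_wpDl.
(* half of e pays for the two estimates, half for the linear term *)
exists (Num.min r (Num.min 1 (e / (2 * (`|d| + 1))))).
  by rewrite !lt_min r0 ltr01.
move=> s Xs; rewrite !lt_min => /and3P[sr s1 sd].
have := rP t Xt; rewrite subrr normr0 -/D (ger0_norm D0) => /(_ r0) ht.
have hs := rP s Xs sr.
have Dst : `|sigma X t - s| <= D + `|s - t|.
  rewrite (_ : _ - s = D - (s - t)); last by rewrite /D; ring.
  by rewrite (le_trans (ler_normB _ _))// (ger0_norm D0).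
rewrite (_ : f s - f t = (f (sigma X t) - f t - d * D) -
   (f (sigma X t) - f s - d * (sigma X t - s)) + d * (s - t)); last first.
  by rewrite /D; ring.
rewrite (splitr e) (le_trans (ler_normD _ _))// lerD//.
  rewrite (le_trans (ler_normB _ _))//.
  have {}hs := le_trans hs (ler_wpM2l (ltW e1) Dst).
  apply: le_trans (lerD ht hs) _; rewrite -mulrDr.
  apply: le_trans (_ : _ <= e / (2 * (D + D + 1)) * (D + D + 1)) _.
    by apply: ler_wpM2l; [exact: ltW|lra].
  by rewrite invfM mulrA mulfVK//; lra.
rewrite normrM; apply: le_trans (ler_wpM2l (normr_ge0 d) (ltW sd)) _.
rewrite invfM [e * _]mulrA mulrCA.
rewrite ler_piMr//; first by lra.
by rewrite ler_pdivrMr ?mul1r ?lerDl// ltr_wpDl.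
Qed.

Lemma left_dense_kappa t : X t -> a < t -> rho X t = t -> kappa X t.
Proof.
move=> Xt at_ rt; have := ts_le Xt; rewrite le_eqVlt => /orP[/eqP tb|].
  by rewrite tb; apply: kappa_max; rewrite -tb.
exact: kappa_lt.
Qed.

(** Prove f a <= f t + e (t - a) by induction on t: the slack e absorbs the error
    in the derivative estimate at right-dense points, a jump does not decrease f,
    and continuity passes to the limit at left-dense points. *)
Lemma delta_deriv_ge0_le f f' : is_antideriv X f' f ->
  (forall t, kappa X t -> 0 <= f' t) -> forall t, X t -> f a <= f t.
Proof.
move=> fP f0 t Xt; apply: (@le_forall_eps _ _ (t - a)) => e e0.
move: t Xt; apply: ts_ind.
- by rewrite subrr mulr0 addr0.
- move=> t Xt tst ht.
  have kt : kappa X t.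
    by apply: kappa_lt => //; apply: lt_le_trans tst (ts_le (sigma_in t)).
  have := delta_deriv_step Xt (fP _ kt).
  have := mulr_ge0 (f0 _ kt) (_ : 0 <= sigma X t - t).
  rewrite subr_ge0 (ltW tst) => /(_ isT).
  have : 0 <= e * (sigma X t - t) by rewrite mulr_ge0 ?subr_ge0 ?(ltW e0) ?(ltW tst).
  lra.
- move=> t Xt tb st ht; have kt : kappa X t by exact: kappa_lt.
  have [r r0 rP] := delta_deriv_dense (fP _ kt) st e0.
  apply/nbhs_ballP; exists r => // s /=; rewrite /ball/= distrC => str Xs ts.
  have := rP s Xs str; rewrite [X in _ <= _ * X]gtr0_norm ?subr_gt0//.
  have := mulr_ge0 (f0 _ kt) (_ : 0 <= s - t).
  rewrite subr_ge0 (ltW ts) => /(_ isT) ? /ler_normlP[]; lra.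
- move=> t Xt at_ rt ht; have kt : kappa X t by exact: left_dense_kappa.
  apply: (@le_forall_eps _ _ 1) => e' e'0.
  have [r r0 rP] := delta_deriv_continuous Xt (fP _ kt) e'0.
  have [s [Xs st rs]] := left_dense_adherent Xt at_ rt r0.
  have := rP s Xs; rewrite ltr0_norm ?subr_lt0//.
  move=> /(_ _)/ler_normlP[|_]; first by lra.
  have := ht s Xs st; have : e * (s - a) <= e * (t - a) by rewrite ler_pM2l//; lra.
  lra.
Qed.

Lemma antideriv_le f g F G : is_antideriv X f F -> is_antideriv X g G ->
    (forall t, kappa X t -> f t <= g t) ->
  forall t, X t -> F t - F a <= G t - G a.
Proof.
move=> fF gG fg t Xt.
have : is_antideriv X (fun t => -1 * f t + g t) (fun t => -1 * F t + G t).
  by move=> u ku; apply: delta_deriv_lin; [exact: fF|exact: gG].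
move=> /delta_deriv_ge0_le/(_ _ _ Xt); rewrite !mulN1r.
suff : forall u, kappa X u -> 0 <= -1 * f u + g u by move=> h /(_ h); lra.
by move=> u /fg; lra.
Qed.

(** * Existence of antiderivatives *)

(** The induction runs on boundedness over [a, t[: continuity at a right-dense point
    and the left limit at a left-dense one both bound f nearby. The bound leaves out
    b, which need not belong to kappa X. *)
Lemma rd_continuous_bounded f : rd_continuous X (kappa X) f ->
  exists K, forall t, X t -> t < b -> `|f t| <= K.
Proof.
move=> frd.
suff : forall t, X t -> exists K, forall s, X s -> s < t -> `|f s| <= K by exact.
apply: ts_ind.
- by exists 0 => s /ts_ge; rewrite ltNge => ->.
- move=> t Xt tst [K KP]; exists (Num.max K `|f t|) => s Xs.
  have [st _|ts|-> _] := ltgtP s t; last by rewrite le_max lexx orbT.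
    by rewrite le_max KP.
  by rewrite ltNge sigma_le.
- move=> t Xt tb st [K KP].
  have [+ _] := frd _ (kappa_lt Xt tb).
  move=> /(_ st)/cvgrPdist_le/(_ 1 ltr01)/nbhs_ballP[r /= r0 rP].
  apply/nbhs_ballP; exists r => // s /= + Xs ts.
  rewrite /ball/= ltr0_norm ?subr_lt0// => sr.
  exists (Num.max K (`|f t| + 1)) => u Xu us; rewrite le_max.
  have [ut|tu] := ltP u t; first by rewrite KP.
  have ub : u < b by exact: lt_le_trans us (ts_le Xs).
  have := rP u _ (kappa_lt Xu ub); rewrite /ball/= distrC.
  rewrite ger0_norm ?subr_ge0// => /(_ _) h.
  apply/orP; right; rewrite -[f u](subKr (f t)) (le_trans (ler_normB _ _))//.
  by rewrite lerD2l h//; lra.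
- move=> t Xt at_ rt ht.
  have [_ /(_ rt)[l]] := frd _ (left_dense_kappa Xt at_ rt).
  move=> /cvgrPdist_le/(_ 1 ltr01)/nbhs_ballP[r /= r0 rP].
  have [s [Xs st rs]] := left_dense_adherent Xt at_ rt r0.
  have [K KP] := ht s Xs st.
  exists (Num.max K (`|l| + 1)) => u Xu ut; rewrite le_max.
  have [us|su] := ltP u s; first by rewrite KP.
  have ub : u < b by exact: lt_le_trans ut (ts_le Xt).
  have := rP u _ (conj (kappa_lt Xu ub) ut); rewrite /ball/=.
  rewrite gtr0_norm ?subr_gt0// => /(_ _) h.
  apply/orP; right; rewrite -[f u](subKr l) (le_trans (ler_normB _ _))//.
  by rewrite lerD2l h//; lra.
Qed.

(** The largest of these functions is the upper Darboux integral of f from a;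
    taking it as a supremum of subsolutions avoids partitions and makes its
    additivity automatic. *)
Definition subsol (f : R -> R) (v : R) : set (R -> R) :=
  [set G | G a = 0 /\ forall p q M, X p -> X q -> p <= q -> q <= v ->
    (forall r, X r -> p <= r -> r < q -> f r <= M) -> G q - G p <= M * (q - p)].

Definition upper_int (f : R -> R) (v : R) : R := sup [set G v | G in subsol f v].

Section UpperIntegral.
Variables (f : R -> R) (K : R).
Hypothesis fK : forall t, X t -> t < b -> `|f t| <= K.

(** With K a bound of |f|, the line of slope - K is a subsolution, and every
    subsolution stays below the line of slope K. *)
Lemma subsol_bounded v : X v -> has_sup [set G v | G in subsol f v].
Proof.
move=> Xv; split.
  exists (- K * (v - a)), (fun t => - K * (t - a)) => //; split.
    by rewrite subrr mulr0.
  move=> p q M Xp Xq; rewrite le_eqVlt => /orP[/eqP-> _ _|pq _ fM].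
    by rewrite !subrr mulr0.
  rewrite -mulrBr opprB addrA subrK ler_pM2r ?subr_gt0//.
  apply: le_trans (fM p Xp (lexx _) pq).
  by have /ler_normlP[] := fK Xp (lt_le_trans pq (ts_le Xq)); rewrite lerNl.
exists (K * (v - a)) => _ [G [G0 GP] <-].
rewrite -[leLHS]subr0 -G0; apply: GP => //; first exact: ts_ge.
move=> r Xr _ rv; apply: le_trans (ler_norm _) (fK _ _) => //.
exact: lt_le_trans rv (ts_le Xv).
Qed.

(** A subsolution up to v restricts to a subsolution up to u. *)
Lemma upper_int_le u v M : X u -> X v -> u <= v ->
  (forall r, X r -> u <= r -> r < v -> f r <= M) ->
  upper_int f v - upper_int f u <= M * (v - u).
Proof.
move=> Xu Xv uv fM; rewrite lerBlDr; apply: ge_sup.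
  by have [] := subsol_bounded Xv.
move=> _ [G [G0 GP] <-].
have Gu : G u <= upper_int f u.
  apply: ub_le_sup; first by have [] := subsol_bounded Xu.
  by exists G => //; split=> // p q m Xp Xq pq qu; apply: GP => //; exact: le_trans uv.
by have := GP _ _ _ Xu Xv uv (lexx v) fM; lra.
Qed.

(** A subsolution up to u continued with slope m is a subsolution up to v, because
    every upper bound of f on a part of [u, v[ is at least m. *)
Lemma upper_int_ge u v m : X u -> X v -> u <= v ->
  (forall r, X r -> u <= r -> r < v -> m <= f r) ->
  m * (v - u) <= upper_int f v - upper_int f u.
Proof.
move=> Xu Xv uv fm; rewrite lerBrDl -lerBrDr; apply: ge_sup.
  by have [] := subsol_bounded Xu.
move=> _ [G [G0 GP] <-]; rewrite lerBrDr.
pose G' t := if t <= u then G t else G u + m * (t - u).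
have -> : G u + m * (v - u) = G' v.
  rewrite /G'; case: ifPn => // vu.
  by rewrite (@le_anti _ _ u v) ?uv// subrr mulr0 addr0.
apply: ub_le_sup; first by have [] := subsol_bounded Xv.
exists G' => //; split; first by rewrite /G' ts_ge.
move=> p q M Xp Xq pq qv fM; rewrite /G'.
have [qu|uq] := leP q u; first by rewrite (le_trans pq qu); exact: GP.
have mM r : X r -> u <= r -> p <= r -> r < q -> m <= M.
  move=> Xr ur pr rq; apply: le_trans (fm r Xr ur _) (fM r Xr pr rq).
  exact: lt_le_trans rq qv.
have [pu|up] := leP p u.
  have := GP p u M Xp Xu pu (lexx _) (fun r Xr pr ru => fM r Xr pr (lt_trans ru uq)).
  have : m * (q - u) <= M * (q - u).
    by rewrite ler_pM2r ?subr_gt0//; exact: (mM u).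
  lra.
move: pq; rewrite le_eqVlt => /orP[/eqP->|pq]; first by rewrite !subrr mulr0.
have : m * (q - p) <= M * (q - p).
  by rewrite ler_pM2r ?subr_gt0//; apply: (mM p) => //; exact: ltW.
lra.
Qed.

(** This is all that differentiating the integral requires: where f oscillates
    little around c, the integral grows like c. *)
Lemma upper_int_approx u v c e : X u -> X v -> u <= v ->
  (forall r, X r -> u <= r -> r < v -> `|f r - c| <= e) ->
  `|upper_int f v - upper_int f u - c * (v - u)| <= e * (v - u).
Proof.
move=> Xu Xv uv fc.
rewrite ler_distl -mulrBl -mulrDl upper_int_ge ?upper_int_le//.
- by move=> r Xr ur rv; have := fc _ Xr ur rv; rewrite ler_distl => /andP[].
- by move=> r Xr ur rv; have := fc _ Xr ur rv; rewrite ler_distl => /andP[].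
Qed.
End UpperIntegral.

(** At a right-dense point f is close to f t nearby. At a right-scattered one the
    increment over the gap [t, sigma t[ is exact, as t is its only point in X, and
    the increment from s to t on the left is small because f is bounded. *)
Lemma rd_continuous_antideriv f : rd_continuous X (kappa X) f ->
  exists F, is_antideriv X f F.
Proof.
move=> frd; have [K fK] := rd_continuous_bounded frd.
exists (upper_int f) => t kt; have Xt : X t by case: kt.
apply/delta_derivP => e e0.
have := sigma_ge Xt; rewrite le_eqVlt => /orP[/eqP/esym st|tst].
  have [/(_ st) + _] := frd t kt.
  move=> /cvgrPdist_le/(_ e e0)/nbhs_ballP[r /= r0 rP]; exists r => // s Xs sr.
  have near_t u : X u -> u < b -> `|u - t| < r -> `|f u - f t| <= e.
    move=> Xu ub ur; rewrite distrC; apply: rP; last exact: kappa_lt.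
    by rewrite /ball/= distrC.
  rewrite st; move: sr; have [ts|st'] := leP t s.
    rewrite ger0_norm ?subr_ge0// => sr.
    rewrite (_ : _ - _ - _ = - (upper_int f s - upper_int f t - f t * (s - t)));
      last by ring.
    rewrite normrN [`|t - s|]distrC [`|s - t|]ger0_norm ?subr_ge0//.
    apply: (upper_int_approx fK) => // u Xu tu us; apply: near_t => //.
      exact: lt_le_trans us (ts_le Xs).
    by rewrite ger0_norm ?subr_ge0//; lra.
  rewrite ltr0_norm ?subr_lt0// => sr; rewrite [`|t - s|]gtr0_norm ?subr_gt0//.
  apply: (upper_int_approx fK) => //; first exact: ltW.
  move=> u Xu su ut; apply: near_t => //; first exact: lt_le_trans ut (ts_le Xt).
  by rewrite ltr0_norm ?subr_lt0//; lra.
have tb : t < b by exact: lt_le_trans tst (ts_le (sigma_in t)).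
have K0 : 0 <= K by exact: le_trans (normr_ge0 _) (fK _ Xt tb).
set D := sigma X t - t; have D0 : 0 < D by rewrite subr_gt0.
have K1 : 0 < 2 * K + 1 by lra.
(* the radius D keeps s out of the points beyond the gap, and the second one makes
   2 K (t - s) at most e D *)
exists (Num.min D (e * D / (2 * K + 1))).
  by rewrite lt_min D0 divr_gt0// mulr_gt0.
move=> s Xs; rewrite lt_min => /andP[sD se].
have ts : s <= t.
  rewrite leNgt; apply/negP => ts; have := sigma_le Xs ts.
  by move: sD; rewrite gtr0_norm ?subr_gt0// /D; lra.
have step : upper_int f (sigma X t) - upper_int f t - f t * D = 0.
  apply/eqP; rewrite -normr_le0 -(mul0r D); apply: (upper_int_approx fK) => //.
  - exact: sigma_in.
  - exact: ltW.
  move=> u Xu; rewrite le_eqVlt => /orP[/eqP<- _|tu]; first by rewrite subrr normr0.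
  by rewrite ltNge sigma_le.
have := @upper_int_approx f K fK s t (f t) (2 * K) Xs Xt ts _.
have fKK u : X u -> s <= u -> u < t -> `|f u - f t| <= 2 * K.
  move=> Xu su ut; rewrite (le_trans (ler_normB _ _))//.
  by have := fK _ Xu (lt_trans ut tb); have := fK _ Xt tb; lra.
move=> /(_ fKK) h.
rewrite (_ : _ - _ - _ = upper_int f t - upper_int f s - f t * (t - s) +
   (upper_int f (sigma X t) - upper_int f t - f t * D)); last by rewrite /D; ring.
rewrite step addr0 (le_trans h)//.
have ts0 : 0 <= t - s by rewrite subr_ge0.
rewrite [`|sigma X t - s|]ger0_norm; last by rewrite subr_ge0 (le_trans ts)// ltW.
move: se; rewrite distrC ger0_norm// ltr_pdivlMr// => se.
apply: le_trans (_ : e * D <= _); first by lra.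
by rewrite ler_pM2l// /D lerD2l lerN2.
Qed.

(** * Rd-continuous functions and their integrals *)

Lemma rd_continuous_ext f g : (forall t, kappa X t -> f t = g t) ->
  rd_continuous X (kappa X) f -> rd_continuous X (kappa X) g.
Proof.
move=> fg frd t kt; have [fc fl] := frd t kt; split.
  move=> /fc; rewrite (fg _ kt); apply: cvg_trans; apply: fmap_within_eq => u.
  by rewrite inE => /fg.
move=> /fl[l fl']; exists l; apply: cvg_trans fl'; apply: fmap_within_eq => u.
by rewrite inE => -[/fg].
Qed.

Lemma rd_continuous_comp (h f : R -> R) : continuous h ->
  rd_continuous X (kappa X) f -> rd_continuous X (kappa X) (h \o f).
Proof.
move=> hc frd t kt; have [fc fl] := frd t kt; split=> [/fc|/fl[l] fl'].
  by move=> /continuous_cvg; apply; exact: hc.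
by exists (h l); apply: continuous_cvg fl'; exact: hc.
Qed.

Lemma rd_continuousM f g : rd_continuous X (kappa X) f ->
  rd_continuous X (kappa X) g -> rd_continuous X (kappa X) (f \* g).
Proof.
move=> frd grd t kt; have [fc fl] := frd t kt; have [gc gl] := grd t kt.
split=> [st|rt]; first exact: cvgM (fc st) (gc st).
have [[l fl'] [m gl']] := (fl rt, gl rt).
by exists (l * m); exact: cvgM.
Qed.

(** Positivity of the left limits cannot be dropped: where f tends to 0 from the
    left, ln f has no finite left limit. *)
Lemma rd_continuous_ln f : rd_continuous X (kappa X) f ->
    (forall t, kappa X t -> 0 < f t) ->
    (forall t l, kappa X t -> a < t -> rho X t = t ->
       f @ within (kappa X `&` [set s | s < t]) (nbhs t) --> l -> 0 < l) ->
  rd_continuous X (kappa X) (fun t => ln (f t)).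
Proof.
move=> frd f0 fl0 t kt; have [fc fl] := frd t kt; split=> [/fc|rt].
  by move=> /continuous_cvg; apply; apply: continuous_ln; exact: f0.
have Xt : X t by case: kt.
have := ts_ge Xt; rewrite le_eqVlt => /orP[/eqP ta|at_].
  (* no point of X lies left of a, so the left limit is taken along an empty set *)
  exists 0 => U _; apply: nearW => s /= [[/ts_ge + _]].
  by rewrite -ta leNgt => /negP.
have [l fl'] := fl rt; exists (ln l).
apply: continuous_cvg (fl'); apply: continuous_ln; exact: fl0 (fl').
Qed.

Lemma delta_derivE f t d : kappa X t -> is_delta_deriv X f t d ->
  delta_deriv X f t = d.
Proof.
move=> kt fd; apply: xget_unique => // d' fd'.
exact: delta_deriv_uniq kt fd' fd.
Qed.

(** Two antiderivatives of the same function bound each other's increments, so the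
    choice made in the definition of the integral is immaterial. *)
Lemma delta_intE f F t : is_antideriv X f F -> X t ->
  delta_int X f a t = F t - F a.
Proof.
move=> fF Xt; rewrite /delta_int; case: xgetP => [G -> fG|/(_ F)//].
by apply/eqP; rewrite eq_le !(antideriv_le fG fF, antideriv_le fF fG).
Qed.

Lemma delta_int_antideriv f : rd_continuous X (kappa X) f ->
  is_antideriv X f (delta_int X f a).
Proof.
move=> /rd_continuous_antideriv exF; rewrite /delta_int.
move: (xget _ _) (xgetPex (fun=> 0) exF) => G fG t kt.
have := delta_deriv_lin 1 (fG t kt) (delta_deriv_cst (- G a) t).
rewrite mul1r addr0.
suff -> : (fun s => 1 * G s + - G a) = fun s => G s - G a by [].
by apply/funext => s; rewrite mul1r.
Qed.

(** The tangent inequality for the exponential, integrated. The left side is the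
    increment over [a, b] of e^C ((1 - C) t + y t + I t), an antiderivative of
    e^C (1 + y^Delta + ln phi - C). *)
Lemma exp_functional_ge phi y I C : rd_continuous X (kappa X) phi ->
  (forall t, kappa X t -> 0 < phi t) ->
  is_antideriv X (fun t => ln (phi t)) I -> C1rd X y ->
  expR C * ((1 - C) * (b - a) + (y b - y a) + (I b - I a))
    <= exp_functional X phi a b y.
Proof.
move=> phird phi0 Iln [yd yrd].
have yP t : kappa X t -> is_delta_deriv X y t (delta_deriv X y t).
  by move=> kt; have [d dP] := yd t kt; rewrite (delta_derivE kt dP).
have Frd := rd_continuousM phird (rd_continuous_comp (@continuous_expR R) yrd).
have GP : is_antideriv X
    (fun t => expR C * ((1 - C) * 1 + (1 * delta_deriv X y t + ln (phi t))) + 0)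
    (fun t => expR C * ((1 - C) * id t + (1 * y t + I t)) + 0).
  move=> t kt; apply: delta_deriv_lin; last exact: delta_deriv_cst.
  apply: delta_deriv_lin; first exact: delta_deriv_id.
  by apply: delta_deriv_lin; [exact: yP|exact: Iln].
have := antideriv_le GP (delta_int_antideriv Frd) _ Xb.
rewrite -[X in _ -> _ <= X]subr0 /exp_functional.
have -> : delta_int X (phi \* (expR \o delta_deriv X y)) a a = 0.
  by rewrite /delta_int subrr.
move=> le_int; apply: le_trans (le_int _).
  by rewrite le_eqVlt; apply/orP; left; apply/eqP => /=; ring.
move=> t kt /=; rewrite -{2}[phi t]lnK ?posrE ?phi0// -expRD.
set x := ln (phi t) + _; rewrite -[x](subrK C) expRD mulrC addr0.
rewrite ler_pM2r ?expR_gt0//; apply: le_trans (expR_ge1Dx _).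
by rewrite /x; lra.
Qed.

End CompactTimeScale.

(** * The minimization problem *)

Theorem theorem84 (R : realType) (T : set R) (a b B : R) (phi : R -> R)
    (T_ts : time_scale T) (Ta : T a) (Tb : T b) (ab : a < b)
    (phi_gt0 : forall t, kappa (ts_itv T a b) t -> 0 < phi t)
    (phi_rd : rd_continuous (ts_itv T a b) (kappa (ts_itv T a b)) phi)
    (phi_left_gt0 : forall t l : R, kappa (ts_itv T a b) t -> a < t ->
       rho (ts_itv T a b) t = t ->
       phi @ within (kappa (ts_itv T a b) `&` [set s | s < t]) (nbhs t) --> l ->
       0 < l) :
  let X := ts_itv T a b in
  let C := (delta_int X (fun t => ln (phi t)) a b + B) / (b - a) in
  let ymin := fun t =>
    - delta_int X (fun s => ln (phi s)) a t + C * (t - a) in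
  [/\ admissible X a b B ymin,
      exp_functional X phi a b ymin = (b - a) * expR C
    & forall y : R -> R, admissible X a b B y ->
        (b - a) * expR C <= exp_functional X phi a b y].
Proof.
move=> X C ymin.
have Xa : X a by split=> //=; rewrite in_itv/= lexx ltW.
have Xb : X b by split=> //=; rewrite in_itv/= lexx ltW.
have Xab : ts_segment X a b.
  split=> //; last by move=> t [] /=; rewrite in_itv.
  by apply: closedI; [exact: itv_closed|case: T_ts].
have ln_rd : rd_continuous X (kappa X) (fun t => ln (phi t)).
  exact (rd_continuous_ln Xab phi_rd phi_gt0 phi_left_gt0).
pose I := delta_int X (fun t => ln (phi t)) a.
have IP : is_antideriv X (fun t => ln (phi t)) I.
  exact (delta_int_antideriv Xab ln_rd).
have I0 : I a = 0 by rewrite /I /delta_int subrr.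
have CE : I b + B = C * (b - a) by rewrite divfK// subr_eq0 gt_eqF.
have yP t : kappa X t -> is_delta_deriv X ymin t (C - ln (phi t)).
  move=> kt.
  rewrite (_ : ymin = fun s => -1 * I s + (C * id s + - (C * a))); last first.
    by apply/funext => s; rewrite /ymin -/(I s) /=; ring.
  rewrite (_ : C - _ = -1 * ln (phi t) + (C * 1 + 0)); last by ring.
  apply: delta_deriv_lin; first exact: IP.
  by apply: delta_deriv_lin; [exact: delta_deriv_id|exact: delta_deriv_cst].
have yE t : kappa X t -> delta_deriv X ymin t = C - ln (phi t).
  by move=> kt; apply: (delta_derivE Xab) => //; exact: yP.
split.
- split.
  + split=> [t kt|]; first by exists (C - ln (phi t)); exact: yP.
    apply: (@rd_continuous_ext _ _ (fun t => C - ln (phi t))) => [t /yE//|].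
    apply: (@rd_continuous_comp _ _ (fun x => C - x)) ln_rd => x.
    by apply: cvgB; [exact: cvg_cst|exact: cvg_id].
  + by rewrite /ymin -/(I a) I0 subrr mulr0 oppr0 addr0.
  + by rewrite /ymin -/(I b) -CE; ring.
- rewrite /exp_functional (delta_intE Xab (F := fun t => expR C * id t + 0)) //.
    by rewrite /=; ring.
  move=> t kt.
  rewrite yE// expRD expRN lnK ?posrE ?phi_gt0// mulrCA divff ?gt_eqF ?phi_gt0//.
  rewrite -[X in is_delta_deriv _ _ _ X]addr0.
  by apply: delta_deriv_lin; [exact: delta_deriv_id|exact: delta_deriv_cst].
- move=> y [yC ya yb].
  have := exp_functional_ge Xab C phi_rd phi_gt0 IP yC.
  apply: le_trans; rewrite ya yb I0 !subr0 mulrC le_eqVlt; apply/orP; left; apply/eqP.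
  rewrite -addrA [B + _]addrC CE; ring.
Qed.
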